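(* Let $\Delta>0$ be real, let $\mathcal X,\mathcal Z$ be linear operators on a complex vector space $V$ with basis $|n\rangle$, $n=0,1,2,\dots$, satisfying $\mathcal Z\mathcal X-\mathcal X\mathcal Z=\mathcal Z^2+\Delta$, and rescale them as $X=\Omega\mathcal X$, $Z=\Omega\mathcal Z$ with $\Omega=\frac{1}{2\sqrt{\Delta}}$, so that $$ZX-XZ=Z^2+\tfrac14 .$$ Suppose that $X,Z$ act tridiagonally, $$X|n\rangle=c_n|n-1\rangle+b_n|n\rangle+a_n|n+1\rangle,\qquad Z|n\rangle=u_n|n-1\rangle+v_n|n\rangle+w_n|n+1\rangle,$$ with $c_0=u_0=0$, $c_n,u_n\neq0$ for $n\ge1$ and $a_n,w_n\ne0$ for $n\ge0$. Let $\delta_0=a_0/w_0$, $\phi_0=c_1/u_1-1$ and $\tilde b_0=b_0-\tfrac12(\delta_0+\phi_0+1)v_0$, and assume $\phi_0-\delta_0\notin\{-1,-2,-3,\dots\}$. Let $a,b,c,d\in\mathbb C$ be defined by $$\phi_0+1=a+c,\qquad -\delta_0=b+d,\qquad v_0=-i\,\frac{a-b-c+d}{2(a+b+c+d)},\qquad \tilde b_0=\frac i4(a+b-c-d).$$ Let $p_n(x)$ be the monic polynomials defined by $p_{-1}=0$, $p_0=1$ and $$x\,p_n(x)=p_{n+1}(x)+b_n\,p_n(x)+a_{n-1}c_n\,p_{n-1}(x),\qquad n\ge0.$$ Then, for all $n\ge0$, $p_n(x)$ is the monic continuous Hahn polynomial of degree $n$ with parameters $a,b,c,d$.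
   Context: $(y)_n=y(y+1)\cdots(y+n-1)$, $(y)_0=1$. The monic continuous Hahn polynomial of degree $n$ with parameters $(a,b,c,d)$ is $$P_n^{(a,b,c,d)}(x)=\frac{i^n\,(a+c)_n(a+d)_n}{(n+a+b+c+d-1)_n}\;{}_3F_2\!\left({-n,\;n+a+b+c+d-1,\;a+ix \atop a+c,\;a+d};1\right).$$ The term $a_{n-1}c_n p_{n-1}$ is understood to be $0$ for $n=0$; the recurrence coefficients $a_n,b_n,c_n$ (with index) are not to be confused with the parameters $a,b,c,d$ (without index). The polynomials $p_n$ are the monic ''eigenfunctions of $X$'': if $\langle x|X=x\langle x|$ and $q_n(x)=\langle x|n\rangle$ (with $q_0=1$), then $p_n=\left(\prod_{i=0}^{n-1}a_i\right)q_n$ satisfies the stated recurrence. For a representation as in the claim, $c_n/u_n=\phi_0+n$ for $n\ge1$ and $a_n/w_n=\delta_0-n$ for $n\ge0$, so $\phi_0,\delta_0,v_0,b_0$ are the free parameters. *)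

(* Defs.v *)
(* MathComp. The field of complex numbers is [R[i]] with [R : realType]. *)
From mathcomp Require Export all_boot all_order all_algebra.
From mathcomp Require Export reals complex.

Set Implicit Arguments.
Unset Strict Implicit.
Unset Printing Implicit Defensive.

Import Order.TTheory GRing.Theory Num.Theory.

Local Open Scope ring_scope.

Definition poch (C : fieldType) (y : C) (n : nat) : C :=
  \prod_(k < n) (y + k%:R).

(* 3F2(-n, al, be; ga, de; z).  The upper parameter -n makes every term of the
   hypergeometric series of index k > n vanish, so the series is this sum. *)
Definition hyp3F2 (C : fieldType) (n : nat) (al be ga de z : C) : C :=
  \sum_(k < n.+1)
    (poch (- n%:R) k * poch al k * poch be k) / (poch ga k * poch de k)
      * (z ^+ k / (k`!)%:R).

Definition monic_cont_hahn (R : realType) (a b c d : R[i]) (n : nat) (x : R[i])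
    : R[i] :=
  'i%C ^+ n * (poch (a + c) n * poch (a + d) n)
    / poch (n%:R + a + b + c + d - 1) n
  * hyp3F2 n (n%:R + a + b + c + d - 1) (a + 'i%C * x) (a + c) (a + d) 1.

(* [e] is a basis in the algebraic sense: every vector is a unique finite
   linear combination of the [e n]. *)
Definition is_basis (C : fieldType) (V : lmodType C) (e : nat -> V) : Prop :=
  (forall (N : nat) (k : nat -> C),
     \sum_(i < N) k i *: e i = 0 -> forall i, (i < N)%N -> k i = 0) /\
  (forall f : V, exists (N : nat) (k : nat -> C), f = \sum_(i < N) k i *: e i).

(* For n = 0 the term in |n-1> is c_0 *: e 0, since 0.-1 = 0; it is zero only
   thanks to the requirement c_0 = 0. *)
Definition tridiagonal (C : fieldType) (V : lmodType C) (e : nat -> V)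
    (T : V -> V) (c_ b_ a_ : nat -> C) : Prop :=
  [/\ forall n, T (e n) = c_ n *: e n.-1 + b_ n *: e n + a_ n *: e n.+1,
      c_ 0%N = 0,
      forall n, (1 <= n)%N -> c_ n != 0
    & forall n, a_ n != 0].

(* The [else] branch encodes p_(-1) = 0: a_(n-1) c_n p_(n-1) is 0 for n = 0. *)
Definition monic_recurrence (C : fieldType) (p : nat -> {poly C})
    (b_ a_ c_ : nat -> C) : Prop :=
  p 0%N = 1 /\
  forall n, 'X * p n =
    p n.+1 + b_ n *: p n
      + (if n is m.+1 then (a_ m * c_ m.+1) *: p m else 0).

(* Main.v *)
Require Import Defs.
From mathcomp Require Import all_boot all_order all_algebra.
From mathcomp Require Import reals complex.
From mathcomp Require Import ring.

(* Comparing coefficients of the basis vectors in ZX - XZ = Z^2 + 1/4 gives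
   a_n = (delta_0 - n) w_n, c_n = (phi_0 + n) u_n, a first-order recursion for
   v_n and for b_n, and one for w_n u_(n+1).  With s = a + b + c + d these are
   solved in closed form, and the nonvanishing of w_n u_(n+1) forces
   (a + d)_n != 0.  After the substitution t = i x and the removal of powers of
   i, everything is rational in a, b, c, d.  Expanded in the basis (a + t)_k,
   the three-term recurrence of the continuous Hahn polynomials becomes a
   rational identity between four neighbouring coefficients, and its coefficients
   are the ones found from the representation. *)

Import Order.TTheory GRing.Theory Num.Theory.
Local Open Scope ring_scope.

(** Indices may repeat in the list, so coefficients are first collected index by index; freeness
    then kills each collected sum. *)
Lemma basis_coef0 (C : fieldType) (V : lmodType C) (e : nat -> V)
    (s : seq (C * nat)) :
  is_basis e -> \sum_(q <- s) q.1 *: e q.2 = 0 ->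
  forall m, \sum_(q <- s) q.1 *+ (q.2 == m) = 0.
Proof.
case=> free_e _ s0 m.
(* The sum of all indices bounds each of them; adding [m] also covers an [m] that does not occur in
   the list. *)
pose N := (m + \sum_(q <- s) q.2).+1.
have ltN q : q \in s -> (q.2 < N)%N.
  move=> qs; rewrite ltnS (big_rem q) //= addnCA; exact: leq_addr.
apply: (free_e N (fun i => \sum_(q <- s) q.1 *+ (q.2 == i))); last first.
  by rewrite ltnS leq_addr.
rewrite -[RHS]s0.
under eq_bigr do rewrite scaler_suml.
rewrite exchange_big; apply: eq_big_seq => q /ltN ltqN /=.
rewrite (bigD1 (Ordinal ltqN)) //= eqxx mulr1n big1 ?addr0 // => i neq_i.
case: eqP => [eq_i|]; last by rewrite mulr0n scale0r.
by case/eqP: neq_i; apply: val_inj.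
Qed.

(** * Scalar relations between the matrix entries *)

Section TridiagonalRelations.
Variables (C : fieldType) (V : lmodType C) (e : nat -> V).
Variables (X Z : {linear V -> V}) (a_ b_ c_ u_ v_ w_ : nat -> C) (h : C).
Hypotheses (e_basis : is_basis e).
Hypothesis ZX : forall f, Z (X f) - X (Z f) = Z (Z f) + h *: f.
Hypotheses (X_tri : tridiagonal e X c_ b_ a_) (Z_tri : tridiagonal e Z u_ v_ w_).

Let XE n : X (e n) = c_ n *: e n.-1 + b_ n *: e n + a_ n *: e n.+1.
Proof. by case: X_tri. Qed.
Let ZE n : Z (e n) = u_ n *: e n.-1 + v_ n *: e n + w_ n *: e n.+1.
Proof. by case: Z_tri. Qed.

(* The nine terms (coefficient, index) of [x *: T1 (T2 (e n))], where the entries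
   of [T1] and [T2] are [c1, b1, a1] and [c2, b2, a2]. *)
Definition tri_comp (a1 b1 c1 a2 b2 c2 : nat -> C) (x : C) (n : nat) :=
  [:: (x * c2 n * c1 n.-1, n.-1.-1); (x * c2 n * b1 n.-1, n.-1);
      (x * c2 n * a1 n.-1, n.-1.+1);
      (x * b2 n * c1 n, n.-1); (x * b2 n * b1 n, n); (x * b2 n * a1 n, n.+1);
      (x * a2 n * c1 n.+1, n); (x * a2 n * b1 n.+1, n.+1);
      (x * a2 n * a1 n.+1, n.+2)].

(** [ZX - XZ - Z^2 - h], applied to [e n], is a vanishing list of 28 terms, read off here at index
    [m]. *)
Lemma commutator_coef n m :
  \sum_(q <- tri_comp w_ v_ u_ a_ b_ c_ 1 n ++ tri_comp a_ b_ c_ w_ v_ u_ (-1) n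
      ++ tri_comp w_ v_ u_ w_ v_ u_ (-1) n ++ [:: (- h, n)])
     q.1 *+ (q.2 == m) = 0.
Proof.
apply: (basis_coef0 _ _ e _ e_basis).
have compE (T1 T2 : {linear V -> V}) a1 b1 c1 a2 b2 c2 x :
    (forall n, T1 (e n) = c1 n *: e n.-1 + b1 n *: e n + a1 n *: e n.+1) ->
    (forall n, T2 (e n) = c2 n *: e n.-1 + b2 n *: e n + a2 n *: e n.+1) ->
    \sum_(q <- tri_comp a1 b1 c1 a2 b2 c2 x n) q.1 *: e q.2
      = x *: T1 (T2 (e n)).
  move=> T1E T2E; rewrite T2E !linearD !linearZ /= !T1E.
  rewrite !big_cons big_nil /= addr0 !scalerDr !scalerA ?mulrA !addrA.
  by rewrite ![x * _]mulrC.
rewrite !big_cat big_seq1 (compE Z X) // (compE X Z) // (compE Z Z) //=.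
by rewrite !scaleN1r scale1r scaleNr addrA ZX -opprD subrr.
Qed.

(** Coefficients two places up and down, one place up and down, and on the diagonal. At the bottom
    of the diagonal the paths through |n-1> are missing, hence the separate relation. *)
Lemma tri_relations n :
  [/\ a_ n * w_ n.+1 - w_ n * a_ n.+1 = w_ n * w_ n.+1,
      c_ n.+2 * u_ n.+1 - u_ n.+2 * c_ n.+1 = u_ n.+2 * u_ n.+1,
      a_ n * v_ n.+1 + b_ n * w_ n - w_ n * b_ n.+1 - v_ n * a_ n
        = w_ n * v_ n.+1 + v_ n * w_ n,
      c_ n.+1 * v_ n + b_ n.+1 * u_ n.+1 - u_ n.+1 * b_ n - v_ n.+1 * c_ n.+1
        = u_ n.+1 * v_ n + v_ n.+1 * u_ n.+1
    & a_ 0 * u_ 1 - w_ 0 * c_ 1 = v_ 0 ^+ 2 + w_ 0 * u_ 1 + h /\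
      c_ n.+1 * w_ n + a_ n.+1 * u_ n.+2 - u_ n.+1 * a_ n - w_ n.+1 * c_ n.+2
        = u_ n.+1 * w_ n + v_ n.+1 ^+ 2 + w_ n.+1 * u_ n.+2 + h].
Proof.
have c0 : c_ 0 = 0 by case: X_tri.
have u0 : u_ 0 = 0 by case: Z_tri.
have neqn m j : (m == (m + j.+1)%N) = false.
  by rewrite -{1}[m]addn0 eqn_add2l.
have neqS m : ((m == m.+1) = false) * ((m == m.+2) = false)
    * ((m == m.+3) = false) * ((m == m.+4) = false).
  by do !split; [move: (neqn m 0)|move: (neqn m 1)|move: (neqn m 2)|move: (neqn m 3)];
     rewrite !addnS addn0.
have neqS' m : ((m.+1 == m) = false) * ((m.+2 == m) = false)
    * ((m.+3 == m) = false) * ((m.+4 == m) = false).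
  by do !split; rewrite eq_sym neqS.
pose E := (eqSS, neqS, neqS', eqxx).
split.
(* Truncated predecessors can merge distinct indices for small [n]; there [c0] and [u0] remove the
   spurious terms. *)
- case: n => [|n].
    have := commutator_coef 0 2; rewrite !big_cons big_nil /= c0 u0 => H.
    by apply/subr0_eq; rewrite -[RHS]H; ring.
  have := commutator_coef n.+1 n.+3; rewrite !big_cons big_nil /=.
  have -> : (n.-1 == n.+3) = false by case: n => // n; rewrite !E.
  by rewrite !E /= => H; apply/subr0_eq; rewrite -[RHS]H; ring.
- have := commutator_coef n.+2 n; rewrite !big_cons big_nil /= !E /= => H.
  by apply/subr0_eq; rewrite -[RHS]H; ring.
- case: n => [|n].
    have := commutator_coef 0 1; rewrite !big_cons big_nil /= c0 u0 => H.
    by apply/subr0_eq; rewrite -[RHS]H; ring.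
  have := commutator_coef n.+1 n.+2; rewrite !big_cons big_nil /=.
  have -> : (n.-1 == n.+2) = false by case: n => // n; rewrite !E.
  by rewrite !E /= => H; apply/subr0_eq; rewrite -[RHS]H; ring.
- case: n => [|n].
    have := commutator_coef 1 0; rewrite !big_cons big_nil /= c0 u0 => H.
    by apply/subr0_eq; rewrite -[RHS]H; ring.
  have := commutator_coef n.+2 n.+1; rewrite !big_cons big_nil /= !E /= => H.
  by apply/subr0_eq; rewrite -[RHS]H; ring.
- split.
    have := commutator_coef 0 0; rewrite !big_cons big_nil /= c0 u0 => H.
    by apply/subr0_eq; rewrite -[RHS]H; ring.
  case: n => [|n].
    have := commutator_coef 1 1; rewrite !big_cons big_nil /= c0 u0 => H.
    by apply/subr0_eq; rewrite -[RHS]H; ring.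
  have := commutator_coef n.+2 n.+2; rewrite !big_cons big_nil /= !E /= => H.
  by apply/subr0_eq; rewrite -[RHS]H; ring.
Qed.

End TridiagonalRelations.

(** * Rising factorials *)

Lemma pochS (C : fieldType) (y : C) n : poch y n.+1 = poch y n * (y + n%:R).
Proof. by rewrite /poch big_ord_recr. Qed.

Lemma pochSl (C : fieldType) (y : C) n : poch y n.+1 = y * poch (y + 1) n.
Proof.
rewrite /poch big_ord_recl /= addr0; congr (_ * _).
by apply: eq_bigr => k _; rewrite -addrA -mulrS.
Qed.

Lemma poch_neq0 (C : fieldType) (y : C) n :
  (forall k, (k < n)%N -> y + k%:R != 0) -> poch y n != 0.
Proof. by move=> y_neq0; apply/prodf_neq0 => k _; apply: y_neq0. Qed.

(** * Three-term recurrence of the continuous Hahn polynomials *)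

Section HahnRecurrence.
Variables (C : numFieldType) (a b c d : C).
Local Notation s := (a + b + c + d).

(* [v_n = i * hahn_nu n], [b_n = i * hahn_beta n], [w_n u_(n+1) = hahn_y n] and
   [a_n c_(n+1) = hahn_gamma n].  The value at n = 0 is split off from the
   general formula, where [s - 2] resp. [s - 1] would cancel: these factors may
   vanish, and 0 / 0 = 0 would then give a wrong value. *)
Definition hahn_nu n : C :=
  - (a - b - c + d) / 2
    * (if n is 0 then s^-1 else (s - 2) / ((s + 2 * n%:R) * (s + 2 * n%:R - 2))).

Definition hahn_beta n : C := (a + b - c - d) / 4 + (a + c - b - d) / 2 * hahn_nu n.

Definition hahn_y n : C :=
  - (a + d + n%:R) * (b + c + n%:R)
    * (if n is 0 then (s ^+ 2 * (s + 1))^-1 else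
         n.+1%:R * (s + n%:R - 1)
           / ((s + 2 * n%:R + 1) * (s + 2 * n%:R) ^+ 2 * (s + 2 * n%:R - 1))).

Definition hahn_gamma n : C := - (b + d + n%:R) * (a + c + n%:R) * hahn_y n.

(* Coefficient of [poch (a + t) k] in [i^(-n) P_n(x)], where [t = i x]. *)
Definition hahn_coef n k : C :=
  poch (a + c) n * poch (a + d) n / poch (n%:R + s - 1) n
    * ((poch (- n%:R) k * poch (n%:R + s - 1) k)
         / (poch (a + c) k * poch (a + d) k) / k`!%:R).

Hypothesis s_neq0 : forall n : nat, s + n%:R != 0.
Hypothesis ac_neq0 : forall n : nat, a + c + n%:R != 0.
Hypothesis ad_neq0 : forall n : nat, a + d + n%:R != 0.

Let nS_neq0 n : n%:R + 1 != 0 :> C.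
Proof. by rewrite natr1 pnatr_eq0. Qed.

(** For n >= 1 the factors are s + (n - 1 + k); for n = 0 the product is empty, so s - 1, which may
    vanish, does not occur. *)
Let den_neq0 n : poch (n%:R + s - 1) n != 0.
Proof.
case: n => [|n]; first by rewrite /poch big_ord0 oner_eq0.
apply: poch_neq0 => k _.
have -> : n.+1%:R + s - 1 + k%:R = s + (n + k)%:R by rewrite natrD; ring.
exact: s_neq0.
Qed.

(** Ratio of consecutive terms of the 3F2, cleared of denominators. *)
Lemma hahn_coefSk n k :
  hahn_coef n k.+1 * ((a + c + k%:R) * (a + d + k%:R) * k.+1%:R)
  = hahn_coef n k * ((k%:R - n%:R) * (n%:R + s - 1 + k%:R)).
Proof.
rewrite /hahn_coef !pochS factS natrM.
have fk : k`!%:R != 0 :> C by rewrite pnatr_eq0 -lt0n fact_gt0.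
have := poch_neq0 _ _ k (fun j _ => ac_neq0 j).
have := poch_neq0 _ _ k (fun j _ => ad_neq0 j).
move: (den_neq0 n) (ac_neq0 k) (ad_neq0 k) (nS_neq0 k) => h1 h2 h3 h4 h5 h6.
by field; rewrite fk h5 h6 h1 h3 h2 addrC h4.
Qed.

Let rising_shift (y : C) k : y * poch (y + 1) k = poch y k * (y + k%:R).
Proof. by rewrite -pochSl pochS. Qed.

(** Ratio in the degree. It stays undivided because n + 1 - k may vanish, and so may s - 1 at n =
    0. *)
Lemma hahn_coefSn n k :
  hahn_coef n.+1 k
    * ((s + 2 * n%:R - 1) * (s + 2 * n%:R) * (n.+1%:R - k%:R))
  = hahn_coef n k
    * ((a + c + n%:R) * (a + d + n%:R) * (n%:R + s - 1 + k%:R) * n.+1%:R).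
Proof.
rewrite /hahn_coef.
have fk : k`!%:R != 0 :> C by rewrite pnatr_eq0 -lt0n fact_gt0.
have := poch_neq0 _ _ k (fun j _ => ac_neq0 j).
have := poch_neq0 _ _ k (fun j _ => ad_neq0 j).
have := den_neq0 n.
have -> : n.+1%:R + s - 1 = n%:R + s - 1 + 1 by rewrite -natr1; ring.
set q := n%:R + s - 1 => den0 ad0 ac0.
have q1_neq0 j : q + 1 + j%:R != 0.
  have -> : q + 1 + j%:R = s + (n + j)%:R by rewrite /q natrD; ring.
  exact: s_neq0.
have den1 : poch (q + 1) n != 0 by apply: poch_neq0 => j _; apply: q1_neq0.
(* [negE] and [qE] are both instances of y (y+1)_k = (y)_k (y+k). *)
have negE : poch (- n.+1%:R) k * (n.+1%:R - k%:R) = poch (- n%:R) k * n.+1%:R :> C.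
  have := rising_shift (- n.+1%:R) k.
  have -> : - n.+1%:R + 1 = - n%:R :> C by rewrite -natr1; ring.
  move/eqP; rewrite -subr_eq0 => /eqP E.
  by apply/subr0_eq; rewrite -[RHS]E; ring.
have qE : poch (q + 1) k * (q + n%:R) / poch (q + 1) n
    = poch q k * (q + k%:R) / poch q n :> C.
  apply/eqP; rewrite eqr_div // -rising_shift -mulrA [(q + _) * _]mulrC.
  by rewrite -rising_shift; apply/eqP; ring.
have -> : s + 2 * n%:R - 1 = q + n%:R by rewrite /q; ring.
have -> : s + 2 * n%:R = q + 1 + n%:R by rewrite /q; ring.
rewrite !pochS; clearbody q.
transitivity (poch (a + c) n * (a + c + n%:R) * (poch (a + d) n * (a + d + n%:R))
    / (poch (a + c) k * poch (a + d) k) / k`!%:R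
  * (poch (- n.+1%:R) k * (n.+1%:R - k%:R))
  * (poch (q + 1) k * (q + n%:R) / poch (q + 1) n)).
  move: (poch (- n.+1%:R) k) (n.+1%:R - k%:R) (q1_neq0 n) => M N q1.
  move: fk ad0 ac0 den1 q1.
  move: (poch (q + 1) n) (poch (q+1) k) (poch (a + c) k) (poch (a + d) k) k`!%:R => *.
  by field; apply/and5P; split.
rewrite negE qE.
move: (poch (- n%:R) k) (n.+1%:R : C) => M N.
move: fk ad0 ac0 den0.
move: (poch q n) (poch q k) (poch (a + c) k) (poch (a + d) k) k`!%:R => *.
by field; apply/and4P; split.
Qed.

Let s_nat n (x : C) : x = s + n%:R -> x != 0.
Proof. by move->; apply: s_neq0. Qed.

Lemma hahn_coef_gt n k : (n < k)%N -> hahn_coef n k = 0.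
Proof.
move=> lt_nk; rewrite /hahn_coef.
suff -> : poch (- n%:R : C) k = 0 by rewrite !mul0r mulr0.
by rewrite /poch (bigD1 (Ordinal lt_nk)) //= addNr mul0r.
Qed.

Lemma hahn_coef00 : hahn_coef 0 0 = 1.
Proof. by rewrite /hahn_coef /poch !big_ord0 fact0 !mulr1 !invr1 !mulr1. Qed.

Lemma hahn_coef10 : hahn_coef 1 0 = (a + c) * (a + d) / s.
Proof.
rewrite /hahn_coef /poch !big_ord1 !big_ord0 fact0 !addr0.
have -> : 1 + s - 1 = s by ring.
by rewrite !mulr1 !invr1 !mulr1.
Qed.

(** This is monicity: the top coefficient is (-1)^n, and with t = i x one has i^n (-1)^n i^n = 1.
    The two ratio lemmas are combined to eliminate [hahn_coef n.+1 n]; this divides by s + 2n - 1,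
    so n = 0 is computed directly. *)
Lemma hahn_coef_diag n : hahn_coef n.+1 n.+1 = - hahn_coef n n.
Proof.
have := hahn_coefSk n.+1 n; have := hahn_coefSn n n.
have s1 : s + 2 * n%:R != 0 by rewrite -natrM.
have p1 := ac_neq0 n; have q1 := ad_neq0 n.
have n1 := nS_neq0 n.
case: n s1 p1 q1 n1 => [|n] s1 p1 q1 n1.
  rewrite hahn_coef10 hahn_coef00 => _ H.
  have {}H : hahn_coef 1 1 * ((a + c) * (a + d)) = - ((a + c) * (a + d)).
    move: H; rewrite !addr0 mulr0 addr0 in s1 *.
    by rewrite mulr1 => ->; field.
  rewrite !addr0 in p1 q1.
  by apply: (mulIf (mulf_neq0 p1 q1)); rewrite H mulN1r.
have s2 : s + 2 * n.+1%:R - 1 != 0.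
  have -> : s + 2 * n.+1%:R - 1 = s + (n + n.+1)%:R by rewrite natrD -natr1; ring.
  exact: s_neq0.
move: (hahn_coef _ _) (hahn_coef _ _) (hahn_coef _ _) => A B D H1 H2.
move: H1 H2.
rewrite -!(natr1 n.+1) => H1 H2.
have K_neq0 : (a + c + n.+1%:R) * (a + d + n.+1%:R) * (n.+1%:R + 1)
    * (s + 2 * n.+1%:R - 1) != 0 by rewrite !mulf_neq0.
apply: (mulIf K_neq0); apply/subr0_eq.
move/eqP: H1; rewrite -subr_eq0 => /eqP H1.
move/eqP: H2; rewrite -subr_eq0 => /eqP H2.
transitivity (0 * (s + 2 * n.+1%:R - 1) - 0 : C); last by ring.
by rewrite -{1}H2 -H1; ring.
Qed.

(* The recurrence read off in the basis [poch (a + t) k], on which [- t] acts by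
   [- t * poch (a + t) k = (a + k) * poch (a + t) k - poch (a + t) k.+1]. *)
Lemma hahn_coef_rec n k :
  (a + k%:R) * hahn_coef n k - (if k is j.+1 then hahn_coef n j else 0)
  = hahn_coef n.+1 k + hahn_beta n * hahn_coef n k
    - (if n is m.+1 then hahn_gamma m * hahn_coef m k else 0).
Proof.
have s0 : s != 0 by have := s_neq0 0; rewrite addr0.
(* Above the degree only k = n + 1 is nontrivial, and there it compares leading coefficients. *)
have [gt_kn|le_kn] := ltnP n k.
  rewrite (hahn_coef_gt n k) // !mulr0 add0r addr0.
  have -> : (if n is m.+1 then hahn_gamma m * hahn_coef m k else 0) = 0.
    case: n gt_kn => // n lt_nk; rewrite hahn_coef_gt ?mulr0 //.
    by rewrite (ltn_trans _ lt_nk).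
  rewrite subr0; case: k gt_kn => // k; rewrite ltnS leq_eqVlt.
  case/predU1P => [<-|lt_nk]; first by rewrite hahn_coef_diag.
  by rewrite !hahn_coef_gt ?oppr0 // ltnS.
case: n le_kn => [|m] le_kn.
  move: le_kn; rewrite leqn0 => /eqP ->.
  rewrite hahn_coef10 hahn_coef00 /hahn_beta /hahn_nu.
  by field.
have s3 : s + 2 * m%:R + 2 != 0
  by apply: (s_nat (m + m).+2); rewrite -!natr1 natrD; ring.
have s2 : s + 2 * m%:R + 1 != 0
  by apply: (s_nat (m + m).+1); rewrite -!natr1 natrD; ring.
have s1 : s + 2 * m%:R != 0
  by apply: (s_nat (m + m)); rewrite natrD; ring.
have p0 := ac_neq0 m; have q0 := ad_neq0 m; have n0 := nS_neq0 m.
(* Only for m = k = 0 is the divisor s + m - 1 + k equal to s - 1, which may vanish. *)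
have [/andP[/eqP m0 /eqP k0]|mk] := boolP ((m == 0%N) && (k == 0%N)).
  have := hahn_coefSn 1 0; rewrite m0 k0 hahn_coef10 hahn_coef00.
  move: (hahn_coef _ _) => A H.
  rewrite m0 mulr0 addr0 in s2 s3.
  have -> : A = (a + c) * (a + d) * (a + c + 1) * (a + d + 1) / ((s + 1) * (s + 2)).
    apply: (@mulIf _ ((s + 1) * (s + 2) * 2)); first by rewrite !mulf_neq0 // pnatr_eq0.
    transitivity (A * ((s + 2 * 1 - 1) * (s + 2 * 1) * (2 - 0))); first by ring.
    by rewrite H; field; rewrite s2 s3 s0.
  rewrite /hahn_beta /hahn_nu /hahn_gamma /hahn_y.
  by field; rewrite s2 s3 s0.
have mk1 : s + m%:R - 1 + k%:R != 0.
  move: mk; case: m {le_kn s1 s2 s3 p0 q0 n0} => [|m] mk; last first.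
    by apply: (s_nat (m + k)%N); rewrite -natr1 natrD; ring.
  case: k mk => // k _; apply: (s_nat k); rewrite -natr1; ring.
have nk : m%:R + 2 - k%:R != 0 :> C.
  have -> : m%:R + 2 - k%:R = (m.+2 - k)%:R :> C.
    by rewrite natrB; [rewrite -!natr1; ring | apply: leqW].
  by rewrite pnatr_eq0 subn_eq0 -ltnNge ltnS.
(* [F], [G] and, for positive [k], [E] reduce all coefficients to a single one, leaving a rational
   identity. *)
have F : hahn_gamma m * hahn_coef m k = hahn_coef m.+1 k *
   ((s + m%:R - 1) * (b + d + m%:R) * (b + c + m%:R) * (m%:R + 1 - k%:R)
    / ((s + 2 * m%:R + 1) * (s + 2 * m%:R) * (s + m%:R - 1 + k%:R))).
  have D0 : (a + c + m%:R) * (a + d + m%:R) * (s + m%:R - 1 + k%:R) * (m%:R + 1) != 0.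
    by rewrite !mulf_neq0.
  apply: (mulIf D0); rewrite mulrAC -mulrA.
  have := hahn_coefSn m k; rewrite -!(natr1 m) => H.
  transitivity (hahn_gamma m * (hahn_coef m.+1 k *
      ((s + 2 * m%:R - 1) * (s + 2 * m%:R) * (m%:R + 1 - k%:R)))).
    by rewrite H; ring.
  move: (hahn_coef m.+1 k) => A; rewrite /hahn_gamma /hahn_y.
  case: m {le_kn nk H} mk mk1 n0 s1 s2 s3 D0 p0 q0 => [|m] mk mk1 n0 s1 s2 s3 D0 p0 q0.
    rewrite addr0 in mk1; rewrite mulr0 addr0 in s2.
    by field; rewrite s0 s2 mk1.
  rewrite -!(natr1 m) in mk1 s1 s2 *.
  field; rewrite mk1 s1 s2 /=.
  by apply: (s_nat (m + m).+1); rewrite -(natr1 (m + m)) natrD; ring.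
have G : hahn_coef m.+2 k = hahn_coef m.+1 k *
   ((a + c + m%:R + 1) * (a + d + m%:R + 1) * (s + m%:R + k%:R) * (m%:R + 2)
    / ((s + 2 * m%:R + 1) * (s + 2 * m%:R + 2) * (m%:R + 2 - k%:R))).
  have D0 : (s + 2 * m%:R + 1) * (s + 2 * m%:R + 2) * (m%:R + 2 - k%:R) != 0.
    by rewrite !mulf_neq0.
  apply: (mulIf D0); rewrite -[RHS]mulrA mulfVK //.
  have := hahn_coefSn m.+1 k; rewrite -!(natr1 m.+1) -!(natr1 m) => H.
  transitivity (hahn_coef m.+2 k *
    ((s + 2 * (m%:R + 1) - 1) * (s + 2 * (m%:R + 1)) * (m%:R + 1 + 1 - k%:R))).
    by ring.
  by rewrite H; ring.
rewrite F G /hahn_beta /hahn_nu; clear F G.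
case: k le_kn mk mk1 nk => [|k] le_kn mk mk1 nk.
  rewrite addr0 in mk1; rewrite subr0 in nk.
  move: (hahn_coef _ _) => A.
  rewrite -?(natr1 m) -?(natr1 k); field.
  have -> : s + 2 * (m%:R + 1) = s + 2 * m%:R + 2 by ring.
  by rewrite mk1 s1 s2 s3 nk.
have E : hahn_coef m.+1 k = hahn_coef m.+1 k.+1 *
   (- (a + c + k%:R) * (a + d + k%:R) * (k%:R + 1)
    / ((m%:R + 1 - k%:R) * (s + m%:R + k%:R))).
  have k1 : m%:R + 1 - k%:R != 0 :> C.
    by move: nk; rewrite -natr1; congr (~~ (_ == _)); ring.
  have m1 : s + m%:R + k%:R != 0.
    by apply: (s_nat (m + k)%N); rewrite natrD; ring.
  have D0 : (m%:R + 1 - k%:R) * (s + m%:R + k%:R) != 0 by rewrite mulf_neq0.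
  apply: (mulIf D0); rewrite -[RHS]mulrA mulfVK //.
  have := hahn_coefSk m.+1 k; rewrite -!(natr1 m) -!(natr1 k) => H.
  apply: oppr_inj.
  transitivity (hahn_coef m.+1 k * ((k%:R - (m%:R + 1)) * (m%:R + 1 + s - 1 + k%:R))).
    by ring.
  by rewrite -H; ring.
rewrite E.
move: (hahn_coef _ _) => A.
rewrite -?(natr1 m) -?(natr1 k); field.
have -> : s + 2 * (m%:R + 1) = s + 2 * m%:R + 2 by ring.
by rewrite -?(natr1 k) in mk1 nk *; rewrite mk1 s1 s2 s3 nk.
Qed.

(** This is i^(-n) P_n(x) at t = i x. *)
Definition hahn_eval n t : C := \sum_(k < n.+1) hahn_coef n k * poch (a + t) k.

Lemma hahn_eval_widen n N t : (n < N)%N ->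
  hahn_eval n t = \sum_(k < N) hahn_coef n k * poch (a + t) k.
Proof.
move=> lt_nN; rewrite /hahn_eval.
rewrite (big_ord_widen N (fun k => hahn_coef n k * poch (a + t) k)) //.
rewrite big_mkcond; apply: eq_bigr => k _.
by case: ltnP => // lt_nk; rewrite hahn_coef_gt ?mul0r.
Qed.

(** The recurrence of P_n divided by i^(n+1): x turns into -t, and the last term changes sign. *)
Lemma hahn_eval_rec n t :
  - t * hahn_eval n t = hahn_eval n.+1 t + hahn_beta n * hahn_eval n t
    - (if n is m.+1 then hahn_gamma m * hahn_eval m t else 0).
Proof.
pose phi k := poch (a + t) k.
have W m : (m < n.+2)%N -> hahn_eval m t = \sum_(k < n.+2) hahn_coef m k * phi k.
  exact: hahn_eval_widen.
have -> : (if n is m.+1 then hahn_gamma m * hahn_eval m t else 0)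
    = \sum_(k < n.+2) (if n is m.+1 then hahn_gamma m * hahn_coef m k else 0) * phi k.
  case: n W => [|m] W; first by rewrite big1 // => k _; rewrite mul0r.
  by rewrite (W m (leqW (leqnSn _))) mulr_sumr; apply: eq_bigr => k _; rewrite mulrA.
rewrite !W // !mulr_sumr -big_split -sumrB /=.
transitivity (\sum_(k < n.+2) (a + k%:R) * hahn_coef n k * phi k
    - \sum_(k < n.+2) (if (k : nat) is j.+1 then hahn_coef n j else 0) * phi k); last first.
  rewrite -sumrB; apply: eq_bigr => k _.
  by rewrite -mulrBl hahn_coef_rec mulrBl mulrDl mulrA.
(* The shifted sum loses its zero term k = 0, the others their zero term k = n + 1; the ranges then
   agree. *)
rewrite [X in _ = _ - X]big_ord_recl mul0r add0r.
rewrite [X in X = _]big_ord_recr [X in _ = X - _]big_ord_recr /=.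
rewrite !(hahn_coef_gt n n.+1) // !(mul0r, mulr0) !addr0 -sumrB.
by apply: eq_bigr => k _; rewrite /= /phi pochS; ring.
Qed.

End HahnRecurrence.

(** * Closed form of the matrix entries *)

Section RepresentationCoefficients.
Variables (C : numFieldType) (im a b c d : C).
Variables (a_ b_ c_ u_ v_ w_ : nat -> C).
Local Notation s := (a + b + c + d).
Hypothesis im2 : im ^+ 2 = -1.
Hypothesis s_neq0 : forall n : nat, s + n%:R != 0.
Hypothesis w_neq0 : forall n, w_ n != 0.
Hypothesis u_neq0 : forall n, u_ n.+1 != 0.
Hypothesis aw : forall n, a_ n * w_ n.+1 - w_ n * a_ n.+1 = w_ n * w_ n.+1.
Hypothesis cu : forall n, c_ n.+2 * u_ n.+1 - u_ n.+2 * c_ n.+1 = u_ n.+2 * u_ n.+1.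
Hypothesis upper : forall n,
  a_ n * v_ n.+1 + b_ n * w_ n - w_ n * b_ n.+1 - v_ n * a_ n
  = w_ n * v_ n.+1 + v_ n * w_ n.
Hypothesis lower : forall n,
  c_ n.+1 * v_ n + b_ n.+1 * u_ n.+1 - u_ n.+1 * b_ n - v_ n.+1 * c_ n.+1
  = u_ n.+1 * v_ n + v_ n.+1 * u_ n.+1.
Hypothesis diag0 : a_ 0%N * u_ 1%N - w_ 0%N * c_ 1%N = v_ 0%N ^+ 2 + w_ 0%N * u_ 1%N + 1 / 4.
Hypothesis diagS : forall n,
  c_ n.+1 * w_ n + a_ n.+1 * u_ n.+2 - u_ n.+1 * a_ n - w_ n.+1 * c_ n.+2
  = u_ n.+1 * w_ n + v_ n.+1 ^+ 2 + w_ n.+1 * u_ n.+2 + 1 / 4.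
Hypothesis a0E : a_ 0%N = - (b + d) * w_ 0%N.
Hypothesis c1E : c_ 1%N = (a + c) * u_ 1%N.
Hypothesis v0E : v_ 0%N = im * hahn_nu C a b c d 0.
Hypothesis b0E : b_ 0%N = im * hahn_beta C a b c d 0.

(** Divided by w_n w_(n+1), [aw] says that a_n / w_n drops by 1 at each step; likewise [cu] makes
    c_n / u_n grow by 1. *)
Lemma rep_aE n : a_ n = - (b + d + n%:R) * w_ n.
Proof.
elim: n => [|n IHn]; first by rewrite addr0.
apply: (mulfI (w_neq0 n)); apply/subr0_eq.
have /eqP := aw n; rewrite -subr_eq0 => /eqP E.
by rewrite -[RHS]oppr0 -{}E IHn -!(natr1 n); ring.
Qed.

Lemma rep_cE n : c_ n.+1 = (a + c + n%:R) * u_ n.+1.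
Proof.
elim: n => [|n IHn]; first by rewrite addr0.
apply: (mulIf (u_neq0 n)); apply/subr0_eq.
have /eqP := cu n; rewrite -subr_eq0 => /eqP E.
by rewrite -{}E IHn -!(natr1 n); ring.
Qed.

Let vb_upper n : - (b + d + n%:R) * (v_ n.+1 - v_ n) + b_ n - b_ n.+1 = v_ n.+1 + v_ n.
Proof.
apply: (mulfI (w_neq0 n)); apply/subr0_eq.
have /eqP := upper n; rewrite rep_aE -subr_eq0 => /eqP E.
by rewrite -[RHS]E; ring.
Qed.

Let vb_lower n : (a + c + n%:R) * (v_ n - v_ n.+1) + b_ n.+1 - b_ n = v_ n + v_ n.+1.
Proof.
apply: (mulfI (u_neq0 n)); apply/subr0_eq.
have /eqP := lower n; rewrite rep_cE -subr_eq0 => /eqP E.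
by rewrite -[RHS]E; ring.
Qed.

Let s_nat n (x : C) : x = s + n%:R -> x != 0.
Proof. by move->; apply: s_neq0. Qed.

Let s0 : s != 0. Proof. by have := s_neq0 0; rewrite addr0. Qed.
Let s1 : s + 1 != 0. Proof. exact: s_neq0 1. Qed.
Let s2n0 n : s + 2 * n%:R != 0.
Proof. by apply: (s_nat (n + n)); rewrite natrD; ring. Qed.
Let s2n1 n : s + 2 * n%:R + 1 != 0.
Proof. by apply: (s_nat (n + n).+1); rewrite -(natr1 (n + n)) natrD; ring. Qed.

(** The recursion for v_n obtained by adding [vb_upper] and [vb_lower]. *)
Lemma hahn_nuS n :
  hahn_nu C a b c d n.+1 * (s + 2 * n%:R + 2) = hahn_nu C a b c d n * (s + 2 * n%:R - 2).
Proof.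
rewrite /hahn_nu -!(natr1 n).
have s2n2 : s + 2 * n%:R + 2 != 0.
  by apply: (s_nat (n + n + 2)%N); rewrite !natrD; ring.
case: n s2n2 (s2n0 n) => [|n] h2 h0.
  by rewrite mulr0 addr0 add0r in h2 *; field; rewrite s0 h2.
have h1 := s2n0 n; rewrite -!(natr1 n) in h0 h2 *.
field.
have -> : s + 2 * (n%:R + 1) - 2 = s + 2 * n%:R by ring.
have -> : s + 2 * (n%:R + 1 + 1) = s + 2 * (n%:R + 1) + 2 by ring.
by rewrite h0 h1 h2.
Qed.

Lemma rep_vbE n : v_ n = im * hahn_nu C a b c d n /\ b_ n = im * hahn_beta C a b c d n.
Proof.
elim: n => [|n [IHv IHb]]; first by split.
have /eqP := vb_upper n; rewrite -subr_eq0 => /eqP U.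
have /eqP := vb_lower n; rewrite -subr_eq0 => /eqP L.
have s2n2 : s + 2 * n%:R + 2 != 0.
  by apply: (s_nat (n + n + 2)%N); rewrite !natrD; ring.
have vS : v_ n.+1 = im * hahn_nu C a b c d n.+1.
  apply: (mulIf s2n2); rewrite -mulrA hahn_nuS mulrA -IHv; apply/subr0_eq.
  transitivity (- (0 + 0) : C); last by ring.
  by rewrite -{1}U -L; ring.
split=> //.
(* The difference of the two equations: b_n - (a + c - b - d) / 2 * v_n does not depend on n, and
   its value is the tilde b_0 of the theorem. *)
have bE : b_ n.+1 = b_ n + (a + c - b - d) / 2 * (v_ n.+1 - v_ n).
  apply: (@mulfI _ 2); first by rewrite pnatr_eq0.
  apply/subr0_eq; transitivity (0 - 0 : C); last by ring.
  by rewrite -{1}L -U; field.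
by rewrite bE vS IHb IHv /hahn_beta; ring.
Qed.

Lemma rep_yE n : u_ n.+1 * w_ n = hahn_y C a b c d n.
Proof.
have nu2 m : v_ m ^+ 2 = - hahn_nu C a b c d m ^+ 2.
  by rewrite (rep_vbE m).1 exprMn im2 mulN1r.
elim: n => [|n IHn].
  move: diag0; rewrite a0E c1E nu2 /hahn_nu /hahn_y => E.
  apply: (mulIf s1).
  (* (s + 1) y_0 = nu_0^2 - 1/4 is a difference of squares; it yields the factors a + d and b +
     c. *)
  transitivity (- (- (- (a - b - c + d) / 2 * s^-1) ^+ 2 + 1 / 4)).
    move/eqP: E; rewrite -subr_eq0 => /eqP E.
    by apply/subr0_eq; rewrite -[RHS]oppr0 -E; ring.
  by rewrite !addr0; field; rewrite s0 s1.
have s2n3 : s + 2 * n%:R + 3 != 0.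
  by apply: (s_nat (n + n + 3)%N); rewrite !natrD; ring.
have s2n2 : s + 2 * n%:R + 2 != 0.
  by apply: (s_nat (n + n + 2)%N); rewrite !natrD; ring.
move: (diagS n); rewrite !rep_aE !rep_cE nu2 => E.
apply: (mulIf s2n3).
(* The diagonal relation, with [a_] and [c_] eliminated, is a first-order recursion for w_n
   u_(n+1). *)
transitivity ((s + 2 * n%:R - 1) * (u_ n.+1 * w_ n) + hahn_nu C a b c d n.+1 ^+ 2 - 1 / 4).
  move/eqP: E; rewrite -subr_eq0 => /eqP E.
  by apply/subr0_eq; rewrite -[RHS]oppr0 -E -!(natr1 n); ring.
rewrite IHn /hahn_nu /hahn_y -!(natr1 n.+1) -!(natr1 n).
move: (s2n0 n) (s2n1 n) s2n2 s2n3.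
case: n {IHn E} => [|n] h0 h1 h2 h3.
  rewrite !mulr0 !addr0 !add0r in h2 h3 *.
  field.
  have -> : s + 2 - 1 = s + 1 by ring.
  have -> : s + 2 - 2 = s by ring.
  by rewrite s0 s1 h2 -addrA natr1 h3.
rewrite -!(natr1 n).
field; apply/and5P; split;
  [apply: (s_nat (n + n + 3)) | apply: (s_nat (n + n + 4))
  | apply: (s_nat (n + n + 5)) | apply: (s_nat (n + n + 2))
  | apply: (s_nat (n + n + 1))]; rewrite !natrD; ring.
Qed.

Hypothesis c_neq0 : forall n, c_ n.+1 != 0.

Lemma rep_ac_neq0 n : a + c + n%:R != 0.
Proof. by have := c_neq0 n; rewrite rep_cE mulf_eq0 negb_or => /andP[]. Qed.

(** a + d + n is a factor of the nonzero product u_(n+1) w_n. *)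
Lemma rep_ad_neq0 n : a + d + n%:R != 0.
Proof.
have := mulf_neq0 (u_neq0 n) (w_neq0 n); rewrite rep_yE.
by apply: contraNneq; rewrite /hahn_y => ->; rewrite oppr0 !mul0r.
Qed.

Lemma rep_gammaE n : a_ n * c_ n.+1 = hahn_gamma C a b c d n.
Proof. by rewrite rep_aE rep_cE /hahn_gamma -rep_yE; ring. Qed.

(** Both sides obey the same second-order recurrence, so two consecutive degrees are carried through
    the induction. *)
Lemma recurrence_hahn_eval (p : nat -> {poly C}) n x :
  monic_recurrence p b_ a_ c_ ->
  (p n).[x] = im ^+ n * hahn_eval C a b c d n (im * x).
Proof.
case=> p0 pS; pose Q k := hahn_eval C a b c d k (im * x).
have Q0 : Q 0%N = 1.
  by rewrite /Q /hahn_eval big_ord1 hahn_coef00 /poch big_ord0 mulr1.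
have QS k : Q k.+1 = - (im * x) * Q k - hahn_beta C a b c d k * Q k
    + (if k is m.+1 then hahn_gamma C a b c d m * Q m else 0).
  rewrite (hahn_eval_rec _ _ _ _ _ s_neq0 rep_ac_neq0 rep_ad_neq0).
  by rewrite -/(Q _) -/(Q _); case: k => [|k]; rewrite ?subr0 -/(Q _); ring.
have PS k : (p k.+1).[x] = x * (p k).[x] - im * hahn_beta C a b c d k * (p k).[x]
    - (if k is m.+1 then hahn_gamma C a b c d m * (p m).[x] else 0).
  have /(congr1 (fun q => q.[x])) := pS k; rewrite mulrC hornerMX !hornerD hornerZ.
  rewrite (rep_vbE k).2 mulrC => ->.
  by case: k => [|k]; rewrite ?hornerZ ?horner0 ?rep_gammaE; ring.
suff : (p n).[x] = im ^+ n * Q n /\ (p n.+1).[x] = im ^+ n.+1 * Q n.+1 by case.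
elim: n => [|n [IH IH']].
  rewrite PS QS p0 hornerC Q0; split; first by rewrite mulr1.
  apply/subr0_eq; transitivity (x * (im ^+ 2 - -1)); first by ring.
  by rewrite im2 subrr mulr0.
split=> //; rewrite PS QS IH IH' !(exprS im n.+1) (exprS im n).
move: (im ^+ n) (hahn_beta _ _ _ _ _ _) (hahn_gamma _ _ _ _ _ _) => P B G.
apply/subr0_eq.
(* The two sides differ by a multiple of im^2 + 1. *)
transitivity ((im ^+ 2 - -1) * (x * im * P * Q n.+1 - G * P * Q n)).
  by ring.
by rewrite im2 subrr mul0r.
Qed.

End RepresentationCoefficients.

(** * Passage to the 3F2 form and assembly *)

Lemma monic_cont_hahnE (R : realType) (a b c d : R[i]) n x :
  monic_cont_hahn a b c d n x = 'i%C ^+ n * hahn_eval _ a b c d n ('i%C * x).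
Proof.
rewrite /monic_cont_hahn /hyp3F2 /hahn_eval -!mulrA; congr (_ * _).
have -> : n%:R + a + b + c + d - 1 = n%:R + (a + b + c + d) - 1 by rewrite !addrA.
rewrite !mulr_sumr; apply: eq_bigr => k _.
rewrite /hahn_coef expr1n. 
move: (poch (n%:R + _ - 1) n) => D.
by rewrite mul1r -!mulrA; ring.
Qed.

Theorem proposition2 (R : realType) (Delta : R) (V : lmodType R[i])
  (e : nat -> V) (calX calZ X Z : {linear V -> V})
  (a_ b_ c_ u_ v_ w_ : nat -> R[i]) (delta0 phi0 tb0 a b c d : R[i])
  (p : nat -> {poly R[i]}) :
  0 < Delta ->
  is_basis e ->
  (forall f, calZ (calX f) - calX (calZ f) = calZ (calZ f) + Delta%:C%C *: f) ->
  (forall f, X f = (1 / (2 * Num.sqrt Delta))%:C%C *: calX f) ->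
  (forall f, Z f = (1 / (2 * Num.sqrt Delta))%:C%C *: calZ f) ->
  tridiagonal e X c_ b_ a_ ->
  tridiagonal e Z u_ v_ w_ ->
  delta0 = a_ 0%N / w_ 0%N ->
  phi0 = c_ 1%N / u_ 1%N - 1 ->
  tb0 = b_ 0%N - 1 / 2 * (delta0 + phi0 + 1) * v_ 0%N ->
  (forall k : nat, phi0 - delta0 != - (k.+1)%:R) ->
  phi0 + 1 = a + c ->
  - delta0 = b + d ->
  v_ 0%N = - 'i%C * ((a - b - c + d) / (2 * (a + b + c + d))) ->
  tb0 = 'i%C / 4 * (a + b - c - d) ->
  monic_recurrence p b_ a_ c_ ->
  forall (n : nat) (x : R[i]), (p n).[x] = monic_cont_hahn a b c d n x.
Proof.
move=> Delta_gt0 e_basis calZX XE ZE X_tri Z_tri delta0E phi0E tb0E phidelta.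
move=> acE bdE v0E tb0E' pE n x.
have [_ _ c_neq0 _] := X_tri; have [_ _ u_neq0 w_neq0] := Z_tri.
(* Every product of two operators acquires the squared scaling factor, and its product with Delta is
   1/4. *)
have ZX f : Z (X f) - X (Z f) = Z (Z f) + (1 / 4) *: f.
  rewrite !(XE, ZE) !linearZ /= -!scalerDr calZX !scalerDr; congr (_ + _).
  rewrite !scalerA -!rmorphM /=; congr (_ *: _).
  set r := Num.sqrt Delta.
  have r0 : r != 0 by rewrite gt_eqF // sqrtr_gt0.
  have -> : 1 / (2 * r) * (1 / (2 * r)) * Delta = 4^-1.
    by rewrite -[Delta]sqr_sqrtr ?ltW // -/r; field.
  by rewrite fmorphV rmorph_nat mul1r.
have rel := tri_relations _ _ _ _ _ _ _ _ _ _ _ _ e_basis ZX X_tri Z_tri.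
(* Since phi0 - delta0 = s - 1, a zero of s + k would give the excluded value -(k+1). *)
have s_neq0 k : a + b + c + d + k%:R != 0.
  have := phidelta k; apply: contraNneq => sk.
  have -> : phi0 - delta0 = (phi0 + 1) + - delta0 - 1 by ring.
  rewrite acE bdE; apply/eqP/subr0_eq; rewrite -[RHS]sk -natr1; ring.
have u1 := u_neq0 1%N isT; have w0 := w_neq0 0%N.
have a0E : a_ 0%N = - (b + d) * w_ 0%N by rewrite -bdE opprK delta0E divfK.
have c1E : c_ 1%N = (a + c) * u_ 1%N by rewrite -acE phi0E subrK divfK.
have v0E' : v_ 0%N = 'i%C * hahn_nu _ a b c d 0.
  have s0 := s_neq0 0%N; rewrite addr0 in s0.
  by rewrite v0E /hahn_nu; field.
have b0E : b_ 0%N = 'i%C * hahn_beta _ a b c d 0.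
  have -> : b_ 0%N = tb0 + 1 / 2 * (delta0 + phi0 + 1) * v_ 0%N.
    by rewrite tb0E subrK.
  have -> : delta0 + phi0 + 1 = (phi0 + 1) - - delta0 by ring.
  by rewrite tb0E' acE bdE v0E' /hahn_beta; field.
rewrite monic_cont_hahnE.
apply: (recurrence_hahn_eval _ _ _ _ _ _ a_ b_ c_ u_ v_ w_) => //.
- exact: sqr_i.
- by move=> m; apply: u_neq0.
- by move=> m; have [] := rel m.
- by move=> m; have [] := rel m.
- by move=> m; have [] := rel m.
- by move=> m; have [] := rel m.
- by have [_ _ _ _ []] := rel 0%N.
- by move=> m; have [_ _ _ _ []] := rel m.
- by move=> m; apply: c_neq0.
Qed.
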